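(* Let $n\geq 1$. The diffeomorphism $I_{2n}\circ\phi_{2n}\colon Y_{2n}\to(\mathbb{P}^1)^{2n}$ maps $K_a\subset Y_{2n}$ onto $S_a\subset(\mathbb{P}^1)^{2n}$ for every $a\in B^n$, i.e. $(I_{2n}\circ\phi_{2n})(K_a)=S_a$; and hence it maps $\mathfrak{B}_{n,n}\subset Y_{2n}$ onto $\widetilde{S}=\bigcup_{a\in B^n}S_a$.
   Context: Fix $N\geq 2n$. Let $E:=\mathbb{C}^N\oplus\mathbb{C}^N$, with standard basis $e_1,\ldots,e_N$ of the first summand and $f_1,\ldots,f_N$ of the second, equipped with the standard hermitian product (for which $e_1,\ldots,e_N,f_1,\ldots,f_N$ is orthonormal); $\perp$ in $E$ refers to it. Let $z\colon E\to E$ be the nilpotent linear map with $ze_j:=e_{j-1}$, $zf_j:=f_{j-1}$ for $2\leq j\leq N$ and $ze_1:=zf_1:=0$. For $k\leq N$ put $E_k:=\mathrm{span}(e_1,\ldots,e_k,f_1,\ldots,f_k)=\ker(z^k)$, and let $z_k\colon E_k\to E_k$ be the restriction of $z$. Let $C\colon E\to\mathbb{C}^2$ be the linear map with $C(e_j):=e$, $C(f_j):=f$ for all $j$, where $\{e,f\}$ is the standard basis of $\mathbb{C}^2$ (with its standard hermitian product). $\mathbb{P}^1$ is the space of complex lines in $\mathbb{C}^2$. For a subspace $W$ and an endomorphism $u$, $u^{-d}W$ denotes the preimage of $W$ under $u^d$. We set $L_0:=0$. For $m\leq N$, $Y_m$ is the smooth complex projective variety of partial flags $0\subsetneq L_1\subsetneq\ldots\subsetneq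 L_m\subset E$ with $\dim L_j=j$ and $zL_j\subset L_j$ for all $j$ (it is independent of the choice of $N\geq m$). The map $$\phi_m\colon Y_m\to(\mathbb{P}^1)^m,\quad \phi_m(L_1,\ldots,L_m):=(C(L_1),C(L_2\cap L_1^\perp),\ldots,C(L_m\cap L_{m-1}^\perp))$$ is a diffeomorphism (Cautis–Kamnitzer). The involutive diffeomorphism $I_{2n}\colon(\mathbb{P}^1)^{2n}\to(\mathbb{P}^1)^{2n}$ sends $(l_1,\ldots,l_{2n})$ to $(l_1',\ldots,l_{2n}')$, where $l_j'=l_j$ if $j$ is odd and $l_j'=l_j^\perp$ (orthogonal complement of the line $l_j$ in $\mathbb{C}^2$) if $j$ is even. The $(n,n)$ Springer variety of complete flags in $E_n$ stabilized by $z_n$ is viewed as the subset $$\mathfrak{B}_{n,n}=\{(L_1,\ldots,L_{2n})\in Y_{2n}\colon L_{2n}=E_n\}.$$ $B^n$ is the set of crossingless matchings of $2n$ points: partitions of $\{1,\ldots,2n\}$ into pairs such that there is no quadruple $i<j<k<l$ with $(i,k)$ and $(j,l)$ paired. For $a\in B^n$, $O_a$ is the set of all $i$ appearing in a pair $(i,j)\in a$ with $i<j$; for such a pair $s_a(i):=j$ and $d_a(i):=(s_a(i)-i+1)/2$ (an integer). Define $$K_a:=\{(L_1,\ldots,L_{2n})\in\mathfrak{B}_{n,n}\colon L_{s_a(j)}=z_n^{-d_a(j)}L_{j-1}\ \forall j\in O_a\},$$ $$S_a:=\{(l_1,\ldots,l_{2n})\in(\mathbb{P}^1)^{2n}\colon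 l_j=l_{s_a(j)}\ \forall j\in O_a\}.$$ By a known theorem of Fung, the sets $K_a$, $a\in B^n$, are the irreducible components of $\mathfrak{B}_{n,n}$; in particular $\mathfrak{B}_{n,n}=\bigcup_{a\in B^n}K_a$. *)

(* Defs.v *)
From HB Require Import structures.
From mathcomp Require Import all_boot all_order all_algebra.
From mathcomp Require Import complex.
From mathcomp Require Import classical_sets reals.

Set Implicit Arguments.
Unset Strict Implicit.
Unset Printing Implicit Defensive.

Import Order.TTheory GRing.Theory Num.Theory.
Local Open Scope classical_set_scope.
Local Open Scope ring_scope.

(* Everything is defined over an arbitrary numClosedFieldType C; the complex
   numbers are C := R[i] with R : realType.
   Basis vectors e_1, ..., e_N, points 1, ..., 2n and components l_1, ..., l_m
   are numbered by ordinals, hence from 0, while the subspaces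
   L_0 = 0, L_1, ..., L_m of a flag keep their number. *)

Section HermitianSpace.
Variable C : numClosedFieldType.

(* Orthogonal complement for the standard hermitian product. *)
Definition perp k (U : {vspace 'rV[C]_k}) : {vspace 'rV[C]_k} :=
  orthov (@dotmx C k) U.

Lemma mem_perp k (U : {vspace 'rV[C]_k}) u :
  reflect {in U, forall v, dotmx u v = 0} (u \in perp U).
Proof. exact: mem_orthovP. Qed.

Lemma dim_cap_perp k (U V : {vspace 'rV[C]_k}) :
  (U <= V)%VS -> (\dim U + \dim (V :&: perp U) = \dim V)%N.
Proof.
move=> sUV; apply/eqP; rewrite eqn_leq; apply/andP; split.
  rewrite -dimv_disjoint_sum; last first.
    apply/eqP; rewrite -subv0; apply/subvP => v.
    rewrite !memv_cap => /and3P[vU _ /mem_perp/(_ v vU)/eqP].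
    by rewrite dnorm_eq0 => /eqP ->; rewrite mem0v.
  by rewrite dimvS // subv_add sUV capvSl.
have main (s : seq 'rV[C]_k) :
    (\dim V <= size s + \dim (V :&: perp <<s>>))%N.
  elim: s => [|u s IH]; first by rewrite span_nil /perp orthov0 capvf.
  apply: leq_trans IH _; rewrite /= addSnnS leq_add2l.
  have le1 := leq_dim_orthov1 (@dotmx C k) u (V :&: perp <<s>>).
  suff : ((\dim (V :&: perp <<s>>)).-1 <= \dim (V :&: perp <<u :: s>>))%N.
    by case: (\dim (V :&: perp <<s>>)).
  apply: (leq_trans le1); apply: dimvS; apply/subvP => v.
  rewrite !memv_cap => /andP[/andP[-> /mem_perp vs]] /mem_orthovP vu.
  apply/mem_perp => w; rewrite span_cons => /memv_addP[x xu [y ys ->]].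
  by rewrite linearDr /= vu // vs // addr0.
by have := main (vbasis U); rewrite size_tuple (span_basis (vbasisP U)).
Qed.

End HermitianSpace.

Section NilpotentMap.
Variables (C : numClosedFieldType) (N : nat).

(* E = C^N (+) C^N; an element of 'rV_(N + N) is an orthonormal coordinate
   vector in the basis e_1, ..., e_N, f_1, ..., f_N. *)
Notation E := 'rV[C]_(N + N).

Definition e (j : 'I_N) : E := delta_mx 0 (lshift N j).
Definition f (j : 'I_N) : E := delta_mx 0 (rshift N j).

(* Vectors are rows, so linear maps act by right multiplication and the rows
   of a matrix are the images of the basis vectors. *)
Definition shift_mx : 'M[C]_N := \matrix_(i, j) (i == j.+1 :> nat)%:R.
Definition z_mx : 'M[C]_(N + N) := block_mx shift_mx 0 0 shift_mx.
Definition z : 'End(E) := linfun (mulmxr z_mx).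

Definition C_mx : 'M[C]_(N + N, 2) :=
  col_mx (\matrix_(i < N) delta_mx 0 0) (\matrix_(i < N) delta_mx 0 1).
Definition Cmap : 'Hom(E, 'rV[C]_2) := linfun (mulmxr C_mx).

Lemma zE v : z v = v *m z_mx. Proof. by rewrite lfunE. Qed.
Lemma CmapE v : Cmap v = v *m C_mx. Proof. by rewrite lfunE. Qed.

Lemma z_e (i j : 'I_N) : i = j.+1 :> nat -> z (e i) = e j.
Proof.
move=> ij; rewrite zE -rowE; apply/rowP => k; rewrite [LHS]mxE.
case: (split_ordP k) => k' ->; rewrite ?block_mxEul ?block_mxEur !mxE /=.
  by rewrite ij eqSS (inj_eq (@lshift_inj _ _)) eq_sym.
by rewrite eq_rlshift.
Qed.

Lemma z_f (i j : 'I_N) : i = j.+1 :> nat -> z (f i) = f j.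
Proof.
move=> ij; rewrite zE -rowE; apply/rowP => k; rewrite [LHS]mxE.
case: (split_ordP k) => k' ->; rewrite ?block_mxEdl ?block_mxEdr !mxE /=.
  by rewrite eq_lrshift.
by rewrite ij eqSS (inj_eq (@rshift_inj _ _)) eq_sym.
Qed.

Lemma z_e0 (i : 'I_N) : i = 0%N :> nat -> z (e i) = 0.
Proof.
move=> i0; rewrite zE -rowE; apply/rowP => k; rewrite [LHS]mxE.
by case: (split_ordP k) => k' ->; rewrite ?block_mxEul ?block_mxEur !mxE ?i0.
Qed.

Lemma z_f0 (i : 'I_N) : i = 0%N :> nat -> z (f i) = 0.
Proof.
move=> i0; rewrite zE -rowE; apply/rowP => k; rewrite [LHS]mxE.
by case: (split_ordP k) => k' ->; rewrite ?block_mxEdl ?block_mxEdr !mxE ?i0.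
Qed.

Lemma Cmap_e (i : 'I_N) : Cmap (e i) = delta_mx 0 0.
Proof. by rewrite CmapE -rowE rowKu rowK. Qed.

Lemma Cmap_f (i : 'I_N) : Cmap (f i) = delta_mx 0 1.
Proof. by rewrite CmapE -rowE rowKd rowK. Qed.

Definition Esub (k : nat) : {vspace E} :=
  (\sum_(j < N | (j < k)%N) (<[e j]> + <[f j]>))%VS.

Definition zpow (d : nat) : 'End(E) := iter d (fun g => (z \o g)%VF) \1%VF.

Lemma zpowE d v : zpow d v = iter d z v.
Proof. by elim: d => [|d IH] /=; rewrite ?id_lfunE // comp_lfunE IH. Qed.

(* Preimage of W under the d-th power of the restriction z_n of z to E_n. *)
Definition zn_preim (n d : nat) (W : {vspace E}) : {vspace E} :=
  (Esub n :&: zpow d @^-1: W)%VS.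

Lemma mem_zn_preim n d W v :
  (v \in zn_preim n d W) = (v \in Esub n) && (iter d z v \in W).
Proof. by rewrite memv_cap -memv_preim zpowE. Qed.

Lemma shift_mxX k i j : (shift_mx ^+ k) i j = (i == (j + k)%N :> nat)%:R.
Proof.
elim: k i j => [|k IH] i j; first by rewrite expr0 mxE addn0.
rewrite exprS mxE; under eq_bigr => l _ do rewrite IH mxE.
case: (ltnP (j + k) N) => jk.
  rewrite (bigD1 (Ordinal jk)) //= eqxx mulr1 addnS big1 ?addr0 // => l.
  by rewrite -val_eqE /= => /negPf ->; rewrite mulr0.
rewrite big1 => [|l _]; last first.
  have /negPf-> : l != (j + k)%N :> nat by rewrite neq_ltn (leq_trans _ jk).
  by rewrite mulr0.
have /negPf-> // : i != (j + k.+1)%N :> nat.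
by rewrite neq_ltn addnS ltnS (leq_trans (ltnW (ltn_ord i))).
Qed.

Lemma z_mxX k : z_mx ^+ k = block_mx (shift_mx ^+ k) 0 0 (shift_mx ^+ k).
Proof.
elim: k => [|k IH]; first by rewrite !expr0 -scalar_mx_block.
rewrite !exprS IH [LHS]mulmx_block.
by rewrite !mulmx0 !mul0mx !addr0 add0r.
Qed.

Lemma iter_zE d v : iter d z v = v *m (z_mx ^+ d).
Proof.
elim: d v => [|d IH] v; first by rewrite expr0 mulmx1.
by rewrite iterS IH zE exprSr -mulmxA.
Qed.

Lemma iter_z_nilp v : iter N z v = 0.
Proof.
rewrite iter_zE z_mxX; suff -> : shift_mx ^+ N = 0.
  by rewrite (_ : block_mx 0 0 0 0 = 0) ?mulmx0 // block_mx0.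
apply/matrixP => i j; rewrite shift_mxX mxE.
have /negPf-> // : i != (j + N)%N :> nat.
by rewrite neq_ltn (leq_trans (ltn_ord i)) // leq_addl.
Qed.

Lemma sum_shift (i j : 'I_N) :
  (i == j)%:R + \sum_(k < N.-1) ((i == (j + k.+1)%N :> nat)%:R
    + (j == (i + k.+1)%N :> nat)%:R) = 1 :> C.
Proof.
wlog le_ij : i j / (j <= i)%N.
  move=> W; case: (leqP j i) => [/W //|/ltnW/W W2]; rewrite -[RHS]W2.
  by rewrite eq_sym; congr (_ + _); apply: eq_bigr => k _; rewrite addrC.
have -> : \sum_(k < N.-1) ((i == (j + k.+1)%N :> nat)%:R
    + (j == (i + k.+1)%N :> nat)%:R)
   = \sum_(k < N.-1) (i == (j + k.+1)%N :> nat)%:R :> C.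
  apply: eq_bigr => k _; have /negPf-> : j != (i + k.+1)%N :> nat.
    by rewrite neq_ltn addnS ltnS (leq_trans le_ij) ?leq_addr.
  by rewrite addr0.
case: (ltnP j i) => ij; last first.
  have -> : i = j by apply/val_inj/eqP; rewrite eqn_leq ij.
  rewrite eqxx big1 ?addr0 // => k _.
  by rewrite -[X in X == _]addn0 eqn_add2l.
have -> : (i == j) = false by rewrite -val_eqE gtn_eqF.
have lt : ((i - j).-1 < N.-1)%N.
  rewrite -ltnS !prednK ?subn_gt0 //; last exact: leq_ltn_trans (ltn_ord i).
  exact: leq_ltn_trans (leq_subr _ _) (ltn_ord i).
rewrite add0r (bigD1 (Ordinal lt)) //= prednK ?subn_gt0 // subnKC // eqxx.
rewrite big1 ?addr0 // => k; rewrite -val_eqE /= => ne.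
case: eqP => // ik; case/eqP: ne.
by rewrite ik addKn.
Qed.

Lemma C_mx_gram : C_mx *m (map_mx Num.conj C_mx^T) =
  1 + \sum_(k < N.-1) (z_mx ^+ k.+1 + map_mx Num.conj (z_mx ^+ k.+1)^T).
Proof.
rewrite /C_mx tr_col_mx map_row_mx mul_col_row.
under eq_bigr => k _ do rewrite z_mxX tr_block_mx map_block_mx add_block_mx.
apply/matrixP => i j; rewrite [RHS]mxE summxE.
case: (split_ordP i) => i' ->; case: (split_ordP j) => j' ->;
  rewrite ?block_mxEul ?block_mxEur ?block_mxEdl ?block_mxEdr.
- under eq_bigr => k _ do rewrite block_mxEul !mxE !shift_mxX conjC_nat.
  rewrite !mxE (inj_eq (@lshift_inj _ _)) sum_shift.
  by rewrite !big_ord_recl big_ord0 !mxE /= conjC1 mulr1 mul0r !addr0.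
- rewrite big1 => [|k _]; last by rewrite block_mxEur trmx0 map_mx0 addr0 mxE.
  rewrite !mxE eq_lrshift addr0.
  by rewrite !big_ord_recl big_ord0 !mxE /= conjC0 mulr0 mul0r !addr0.
- rewrite big1 => [|k _]; last by rewrite block_mxEdl trmx0 map_mx0 addr0 mxE.
  rewrite !mxE eq_rlshift addr0.
  by rewrite !big_ord_recl big_ord0 !mxE /= conjC0 mulr0 mul0r !addr0.
- under eq_bigr => k _ do rewrite block_mxEdr !mxE !shift_mxX conjC_nat.
  rewrite !mxE (inj_eq (@rshift_inj _ _)) sum_shift.
  by rewrite !big_ord_recl big_ord0 !mxE /= conjC1 mulr1 mul0r !addr0 add0r.
Qed.

Lemma Cmap_isometry v w :
    (forall k, dotmx v (iter k.+1 z w) = 0) ->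
    (forall k, dotmx (iter k.+1 z v) w = 0) ->
  dotmx (Cmap v) (Cmap w) = dotmx v w.
Proof.
move=> vzw zvw; rewrite !CmapE !dotmxE trmx_mul map_mxM mulmxA.
rewrite -(mulmxA v) C_mx_gram mulmxDr mulmx1 mulmxDl mxE.
rewrite mulmx_sumr mulmx_suml summxE big1 ?addr0 // => k _.
rewrite mulmxDr mulmxDl mxE.
move: (zvw k) (vzw k); rewrite !iter_zE !dotmxE => ->.
by rewrite trmx_mul map_mxM mulmxA => ->; rewrite addr0.
Qed.

(* L_j for 0 <= j <= m, with the convention L_0 = 0. *)
Definition step m (L : m.-tuple {vspace E}) (j : nat) : {vspace E} :=
  nth 0%VS (0%VS :: L) j.

(* The dimensions make the inclusions strict. *)
Definition is_flag m (L : m.-tuple {vspace E}) : bool :=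
  [forall j : 'I_m, [&& \dim (step L j.+1) == j.+1,
     (step L j <= step L j.+1)%VS &
     (z @: step L j.+1 <= step L j.+1)%VS]].

Definition Y m := {L : m.-tuple {vspace E} | is_flag L}.

Definition P1 := {l : {vspace 'rV[C]_2} | \dim l == 1%N}.

Section Phi.
Variables (m : nat) (L : Y m) (j : 'I_m).

Let A := step (val L) j.
Let B := step (val L) j.+1.

Lemma flag_dim : \dim B = j.+1.
Proof. by have /forallP/(_ j)/and3P[/eqP] := valP L. Qed.

Lemma flag_dim_pred : \dim A = j.
Proof.
rewrite /A; case: (nat_of_ord j) (ltn_ord j) => [|i] ltim.
  by rewrite /step /= dimv0.
by have /forallP/(_ (Ordinal (ltnW ltim)))/and3P[/eqP] := valP L.
Qed.

Lemma flag_sub : (A <= B)%VS.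
Proof. by have /forallP/(_ j)/and3P[] := valP L. Qed.

Lemma flag_stable : (z @: B <= B)%VS.
Proof. by have /forallP/(_ j)/and3P[] := valP L. Qed.

Lemma flag_stable_pred : (z @: A <= A)%VS.
Proof.
rewrite /A; case: (nat_of_ord j) (ltn_ord j) => [|i] ltim; first by rewrite /step /= limg0.
by have /forallP/(_ (Ordinal (ltnW ltim)))/and3P[] := valP L.
Qed.

Lemma flag_z_sub : (z @: B <= A)%VS.
Proof.
apply/subvP => _ /memv_imgP[v vB ->].
have [vA|vNA] := boolP (v \in A).
  by apply: (subvP flag_stable_pred); apply: memv_img.
have defB : (A + <[v]>)%VS = B.
  apply/eqP; rewrite eqEdim subv_add flag_sub -memvE vB /=.
  rewrite dimv_disjoint_sum; last first.
    apply/eqP; rewrite -subv0; apply/subvP => w.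
    rewrite memv_cap => /andP[wA /vlineP[c wE]]; move: wA; rewrite wE.
    have [->|c0] := eqVneq c 0; first by rewrite scale0r !mem0v.
    by move/(memvZ c^-1); rewrite scalerK // => vA; case/negP: vNA.
  rewrite dim_vline flag_dim flag_dim_pred.
  have -> : v != 0 by apply: contraNneq vNA => ->; apply: mem0v.
  by rewrite addn1.
have : z v \in B by apply: (subvP flag_stable); apply: memv_img.
rewrite -defB => /memv_addP[u uA [_ /vlineP[c ->] zv]].
suff c0 : c = 0 by rewrite zv c0 scale0r addr0.
have zk k : iter k z v - c ^+ k *: v \in A.
  elim: k => [|k IH]; first by rewrite expr0 scale1r subrr mem0v.
  have := subvP flag_stable_pred _ (memv_img z IH).
  rewrite linearB linearZ /= zv scalerDr scalerA -exprSr opprD addrA.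
  by rewrite addrAC => H; rewrite -(subrK (c ^+ k *: u) (_ - _))
     rpredD // rpredZ // addrAC.
have := zk N; rewrite iter_z_nilp sub0r rpredN rpredZeq.
by case/orP=> [|vA]; [rewrite expf_eq0 => /andP[_ /eqP] | case/negP: vNA].
Qed.

Lemma flag_line_dim : \dim (Cmap @: (B :&: perp A)) == 1%N.
Proof.
rewrite limg_dim_eq.
  rewrite -(eqn_add2l (\dim A)) dim_cap_perp ?flag_sub //.
  by rewrite flag_dim flag_dim_pred addn1.
apply/eqP; rewrite -subv0; apply/subvP => v.
rewrite !memv_cap memv_ker => /andP[/andP[vB /mem_perp vA] /eqP Cv].
have zkA k : iter k.+1 z v \in A.
  elim: k => [|k IH]; first exact: (subvP flag_z_sub _ (memv_img z vB)).
  exact: (subvP flag_stable_pred _ (memv_img z IH)).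
have : dotmx (Cmap v) (Cmap v) = dotmx v v.
  apply: Cmap_isometry => k; first exact: vA.
  by apply/eqP; rewrite herm_eq0C /=; apply/eqP/vA/zkA.
by rewrite Cv linear0l memv0 -(dnorm_eq0 (@dotmx C _)) /= => <-.
Qed.

Definition phi_line : P1 := Sub (Cmap @: (B :&: perp A))%VS flag_line_dim.

End Phi.

(* For j = 0 the component is C(L_1), because L_0^perp = E. *)
Definition phi m (L : Y m) : m.-tuple P1 := [tuple phi_line L j | j < m].

Definition springer n : set (Y (2 * n)) :=
  [set L | step (val L) (2 * n) = Esub n].

End NilpotentMap.

Section ProjectiveLine.
Variable C : numClosedFieldType.

Lemma dim_perp_line (l : P1 C) : \dim (perp (val l)) == 1%N.
Proof.
have := dim_cap_perp (subvf (val l)); rewrite capfv dimvf /dim /=.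
by rewrite (eqP (valP l)) mul1n add1n => -[->].
Qed.

Definition perp_line (l : P1 C) : P1 C := Sub (perp (val l)) (dim_perp_line l).

(* Ordinal i stands for l_(i+1), so the l_j with j even are those with i odd. *)
Definition invol m (l : m.-tuple (P1 C)) : m.-tuple (P1 C) :=
  [tuple if odd i then perp_line (tnth l i) else tnth l i | i < m].

End ProjectiveLine.

Definition is_matching n (a : {set {set 'I_(2 * n)}}) : bool :=
  [&& finset.partition a [set: 'I_(2 * n)]%SET, [forall p in a, #|p| == 2] &
   ~~ [exists i : 'I_(2 * n), exists j : 'I_(2 * n), exists k : 'I_(2 * n),
       exists l : 'I_(2 * n), [&& (i < j < k)%N, (k < l)%N,
       [set i; k]%SET \in a & [set j; l]%SET \in a]]].

Definition matching n := {a : {set {set 'I_(2 * n)}} | is_matching a}.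

Section Matching.
Variables (n : nat) (a : matching n).

Definition opening : {set 'I_(2 * n)} :=
  [set i : 'I_(2 * n) | [exists j : 'I_(2 * n), (i < j)%N && ([set i; j]%SET \in val a)]]%SET.

(* The value i outside opening is a dummy. *)
Definition partner (i : 'I_(2 * n)) : 'I_(2 * n) :=
  odflt i [pick j : 'I_(2 * n) | (i < j)%N && ([set i; j]%SET \in val a)].

Lemma partnerP (i j : 'I_(2 * n)) : i \in opening ->
  partner i = j <-> (i < j)%N && ([set i; j]%SET \in val a).
Proof.
rewrite inE => /existsP[j0 j0P]; rewrite /partner.
case: pickP => [k kP|/(_ j0)]; last by rewrite j0P.
split=> [<- //|/andP[ij ija]]; have /andP[ik ika] := kP.
have /and3P[/and3P[_ /finset.trivIsetP tI _] _ _] := valP a.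
have [eqp|/(tI _ _ ika ija)/disjoint_setI0/finset.setP/(_ i)] :=
  eqVneq [set i; k]%SET [set i; j]%SET; last by rewrite !inE eqxx.
have : k \in [set i; j]%SET by rewrite -eqp !inE eqxx orbT.
by rewrite !inE -val_eqE gtn_eqF //= => /eqP.
Qed.

Definition half_gap (i : 'I_(2 * n)) : nat := ((partner i - i + 1) %/ 2)%N.

(* L_(s_a(j)) = z_n^(- d_a(j)) L_(j - 1), with the points numbered from 0. *)
Definition Kset (C : numClosedFieldType) N : set (Y C N (2 * n)) :=
  [set L | springer L /\ forall j, j \in opening ->
     step (val L) (partner j).+1 =
     zn_preim n (half_gap j) (step (val L) j)].

Definition Sset (C : numClosedFieldType) : set ((2 * n).-tuple (P1 C)) :=
  [set l | forall j, j \in opening -> tnth l j = tnth l (partner j)].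

End Matching.

Definition Stilde (C : numClosedFieldType) n : set ((2 * n).-tuple (P1 C)) :=
  \bigcup_(a in [set: matching n]) @Sset n a C.

(* Main.v *)
Require Import Defs.
From mathcomp Require Import all_boot all_order all_algebra.
From mathcomp Require Import complex.
From mathcomp Require Import classical_sets reals.
From mathcomp Require Import zify.

(** Throughout, points are numbered from 0, so that point i stands for the
    inclusion of L_i in L_(i+1) and contributes the line
    l_i = C (L_(i+1) :&: L_i^perp).  An arc (i, j) of a matching imposes
    L_(j+1) = z^-d L_i, with 2d = j + 1 - i, on the flags of K_a, and the
    equality of the components i and j on the tuples of S_a.  Arcs join points
    of opposite parity, so that the involution turns this equality into
    orthogonality of l_j and l_i.  The two conditions have to be compared.

    Let first j = i + 1, and put A = L_i.  The orthogonal complement of A in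
    z^-1 A is a plane, which C maps isometrically onto C^2 ([slice_isometry],
    [Cmap_slice]).  In this plane L_(i+1) cuts out one line, and its orthogonal
    line is the complement of L_(i+1) in z^-1 A.  Hence L_(i+2) = z^-1 A if and
    only if l_(i+1) is orthogonal to l_i ([eq_lpreim_line]).

    For a general arc, the arcs below it give L_j = z^-c L_(i+1) with
    c = d - 1.  The map z^c is isometric on the complement of its kernel, and
    there it commutes with C in the sense that C z^c = C.  It therefore carries
    the inclusion of L_j in L_(j+1) to an inclusion of L_(i+1) in a z-stable
    space M, without changing the line ([zpow_transport]).  This reduces the
    claim to the previous case ([linked_arc]).  The arcs are treated from the
    inside to the outside with the induction principle [noncrossing_ind],
    applied to the relation [linked]: reflexivity and transitivity of this
    relation account for arcs which stand side by side.  For the pair (0, 2n)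
    it says L_(2n) = z^-n 0 = E_n, which is why a flag that satisfies all arc
    conditions lies in the Springer variety ([Kset_linked]).

    Together with the surjectivity of phi ([phi_surj]) this proves that K_a
    is mapped onto S_a.  The second claim follows from the first and from
    Fung's theorem that the K_a cover the Springer variety
    ([springer_covered]).  To see the latter, let b_k be the largest b with
    ker z^b contained in L_k; so z has Jordan type (k - b_k, b_k) on L_k.  For
    a flag that ends in E_n, the heights k - 2 b_k form a Dyck path.  Join
    every up-step of this path to the down-step of its first return; the flag
    satisfies the conditions of this matching ([linked_first_return]). *)

Set Implicit Arguments.
Unset Strict Implicit.
Unset Printing Implicit Defensive.

Import Order.TTheory GRing.Theory Num.Theory.
Local Open Scope ring_scope.

(** * Noncrossing matchings *)
Section Arcs.
Local Open Scope nat_scope.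
Variables (n : nat) (a : matching n).

Definition arc (i j : 'I_(2 * n)) : bool :=
  (i < j) && ([set i; j]%SET \in val a).

Lemma opening_arc i : i \in opening a -> arc i (partner a i).
Proof. by move=> ia; apply/(partnerP _ ia). Qed.

Lemma arc_opening i j : arc i j -> i \in opening a.
Proof. by move=> aij; rewrite inE; apply/existsP; exists j. Qed.

Lemma arc_partner i j : arc i j -> partner a i = j.
Proof. by move=> aij; apply/(partnerP _ (arc_opening aij)). Qed.

Lemma arc_lt i j : arc i j -> i < j. Proof. by case/andP. Qed.

Lemma arc_inj i j i' j' x : arc i j -> arc i' j' ->
  x \in [set i; j]%SET -> x \in [set i'; j']%SET -> i = i' /\ j = j'.
Proof.
move=> /andP[ij ija] /andP[ij' ija'] xij xij'.
have /and3P[/and3P[_ /finset.trivIsetP tI _] _ _] := valP a.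
have [eqp|/(tI _ _ ija ija')/disjoint_setI0/finset.setP/(_ x)] :=
  eqVneq [set i; j]%SET [set i'; j']%SET; last first.
  by rewrite finset.in_setI xij xij' inE.
have : i \in [set i'; j']%SET by rewrite -eqp !inE eqxx.
have : j \in [set i'; j']%SET by rewrite -eqp !inE eqxx orbT.
by rewrite !inE => /orP[]/eqP ej /orP[]/eqP ei; subst; rewrite //; lia.
Qed.

Lemma arc_disjoint i j k l : arc i j -> arc k l ->
  (i = k /\ j = l) \/
  [/\ k <> i :> nat, k <> j :> nat, l <> i :> nat & l <> j :> nat].
Proof.
move=> aij akl.
case dis: [disjoint [set i; j]%SET & [set k; l]%SET]; last first.
  by left; move/pred0Pn: dis => [x /= /andP[]]; apply: arc_inj.
right; have {dis}H x : x \in [set i; j]%SET -> x \notin [set k; l]%SET.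
  by move=> xi; apply/negP => xk; move/pred0P/(_ x): dis; rewrite /= xi xk.
move: (H i) (H j); rewrite !inE !eqxx orbT -!val_eqE /=.
by move=> /(_ isT) ? /(_ isT) ?; split; lia.
Qed.

Lemma arc_cover x : exists i j, arc i j /\ x \in [set i; j]%SET.
Proof.
have /and3P[/and3P[/eqP covT _ _] /forall_inP card2 _] := valP a.
have : x \in finset.cover (val a) by rewrite covT inE.
case/finset.bigcupP => B Ba; have /cards2P[i [j [ij defB]]] := card2 _ Ba.
move: Ba; rewrite defB => Ba xB; move: ij; rewrite -val_eqE neq_ltn.
case/orP => lt; [exists i, j | exists j, i].
  by rewrite /arc lt.
by rewrite /arc lt finset.setUC.
Qed.

Lemma arc_noncrossing i j k l :
  arc i k -> arc j l -> i < j -> j < k -> k < l -> False.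
Proof.
move=> /andP[_ ika] /andP[_ jla] ij jk kl.
have /and3P[_ _ /existsP[]] := valP a; exists i; apply/existsP; exists j.
by apply/existsP; exists k; apply/existsP; exists l; apply/and4P; split;
   rewrite ?ij ?jk.
Qed.

Let arc_closed p q := forall i j, arc i j -> (p <= i < q) = (p <= j < q).

(** Induction from inner to outer arcs.  Positions, the arguments of R, are the
    2n + 1 gaps around the points.  The interior of an arc is a union of
    blocks because arcs do not cross, so such intervals split into consecutive
    outermost arcs, and R chains up along them. *)
Lemma noncrossing_ind (R : nat -> nat -> Prop) :
    (forall p, R p p) -> (forall p q r, R p q -> R q r -> R p r) ->
    (forall i j, arc i j -> R i.+1 j -> R i j.+1) ->
  (forall i j, arc i j -> R i.+1 j /\ R i j.+1) /\ R 0 (2 * n).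
Proof.
move=> Rxx Rtr Rarc.
have arc_closed_inner i j : arc i j -> arc_closed i.+1 j.
  move=> aij k l akl; have := arc_lt aij; have := arc_lt akl => kl ij.
  have := arc_noncrossing aij akl; have := arc_noncrossing akl aij.
  by have [[<- <-]|[]] := arc_disjoint aij akl; lia.
have Rclosed m p q : q - p < m -> p <= q <= 2 * n -> arc_closed p q -> R p q.
  elim: m p q => // m IH p q qpm /andP[].
  rewrite leq_eqVlt => /predU1P[-> //|pq] q2n cl.
  have p2n : p < 2 * n by exact: leq_trans q2n.
  have [i [j [aij]]] := arc_cover (Ordinal p2n).
  have clij := cl _ _ aij; have ij := arc_lt aij.
  rewrite !inE => /orP[]/eqP ep; move: clij ij; rewrite -ep /=; last by lia.
  rewrite leqnn pq /= => /esym/andP[pj jq] _.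
  have ip : i = p :> nat by rewrite -ep.
  apply: (Rtr _ j.+1).
    rewrite -ip; apply: Rarc => //; apply: IH; last exact: arc_closed_inner.
      by have := arc_lt aij; lia.
    by have := arc_lt aij; have := ltn_ord j; lia.
  apply: IH; [lia | lia |].
  move=> k l akl; have := cl _ _ akl; have := arc_closed_inner _ _ aij _ _ akl.
  have := arc_lt akl => kl.
  have [[<- <-]|[]] := arc_disjoint aij akl; have := arc_lt aij; lia.
split=> [i j aij|].
  suff Rij : R i.+1 j by split=> //; apply: Rarc.
  apply: (Rclosed (j - i.+1).+1) => //; last exact: arc_closed_inner.
  by have := arc_lt aij; have := ltn_ord j; lia.
apply: (Rclosed (2 * n - 0).+1); rewrite ?leqnn //.
by move=> i j _; rewrite !ltn_ord.
Qed.

(** The interior of an arc consists of whole pairs. *)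
Lemma arc_odd i j : arc i j -> odd j = ~~ odd i.
Proof.
move=> aij; pose R p q := odd p = odd q.
have [||k l _|H _] := @noncrossing_ind R; rewrite /R //=.
- by move=> p q r ->.
- by move=> <-; rewrite negbK.
- by case: (H _ _ aij) => <-.
Qed.

End Arcs.

Section DyckPath.
Local Open Scope nat_scope.

(** Join each up-step i of the path to the first later step j after which the
    height is back at h i.  Equivalently, j is a down-step and i the last step
    before it that starts at the height h (j + 1); so every step has exactly
    one partner.  Two crossing arcs (i, k) and (j, l), with i < j < k < l,
    would give h i < h j < h (k + 1) = h i. *)
Lemma dyck_matching n (h : nat -> nat) : h 0 = 0 -> h (2 * n) = 0 ->
    (forall k, k < 2 * n -> h k.+1 = (h k).+1 \/ h k = (h k.+1).+1) ->
  exists a : matching n, forall i j : 'I_(2 * n), arc a i j ->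
    h i = h j.+1 /\ (forall k, i < k <= j -> h i < h k).
Proof.
move=> h0 h2n hstep.
pose A (i j : 'I_(2 * n)) := [&& i < j, h i == h j.+1 &
  [forall k : 'I_(2 * n), (i < k <= j) ==> (h i < h k)]].
have AP i j : A i j ->
    [/\ i < j, h i = h j.+1 & forall k, i < k <= j -> h i < h k].
  move=> /and3P[ij /eqP hij /forall_inP H]; split=> // k /andP[ik kj].
  have k2n : k < 2 * n by apply: leq_ltn_trans kj (ltn_ord j).
  by have := H (Ordinal k2n); apply; rewrite ik.
have PA (i j : 'I_(2 * n)) : i < j -> h i = h j.+1 ->
    (forall k, i < k <= j -> h i < h k) -> A i j.
  move=> ij hij H; rewrite /A ij hij eqxx /=.
  by apply/forall_inP => k /H; rewrite hij.
have Ainj i j i' j' x : A i j -> A i' j' ->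
    x \in [set i; j]%SET -> x \in [set i'; j']%SET -> i = i' /\ j = j'.
  move=> /AP[ij hij Hij] /AP[ij' hij' Hij'].
  have := Hij i'; have := Hij j'; have := Hij i'.+1; have := Hij j'.+1.
  have := Hij' i; have := Hij' j; have := Hij' i.+1; have := Hij' j.+1.
  move=> H1 H2 H3 H4 H5 H6 H7 H8.
  by rewrite !inE => /orP[]/eqP-> /orP[]/eqP ei;
    split; apply: val_inj; subst; move=> /=; lia.
pose a := [set B : {set 'I_(2 * n)} |
  [exists i, exists j, A i j && (B == [set i; j])%SET]]%SET.
have aP B : reflect (exists i j, A i j /\ B = [set i; j]%SET) (B \in a).
  rewrite inE; apply: (iffP existsP); case=> i.
    by move=> /existsP [j /andP[Aij /eqP->]]; exists i, j.
  by move=> [j [Aij ->]]; exists i; apply/existsP; exists j; rewrite Aij eqxx.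
have aA (i j : 'I_(2 * n)) : i < j -> [set i; j]%SET \in a -> A i j.
  move=> ij /aP[i' [j' [Aij' e]]]; have [ij' _ _] := AP _ _ Aij'.
  have : i \in [set i'; j']%SET by rewrite -e !inE eqxx.
  have : j \in [set i'; j']%SET by rewrite -e !inE eqxx orbT.
  rewrite !inE => /orP[]/eqP ej /orP[]/eqP ei; subst; rewrite //; lia.
have up_arc (i : 'I_(2 * n)) : h i.+1 = (h i).+1 -> exists j, A i j.
  move=> hi.
  have i2n := ltn_ord i.
  have ilast : i < (2 * n).-1.
    have : i.+1 != 2 * n by apply/eqP => e; move: hi; rewrite e h2n.
    by lia.
  have last : (2 * n).-1.+1 = 2 * n by lia.
  have [|j /andP[ij hj] jmin] :=
    @ex_minnP (fun j => (i < j) && (h j.+1 <= h i)).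
    by exists (2 * n).-1; rewrite last h2n ilast.
  have j2n : j < 2 * n.
    by have := jmin (2 * n).-1; rewrite last h2n ilast => /(_ isT); lia.
  have hlt k : i < k <= j -> h i < h k.
    move=> /andP[ik kj]; case: (eqVneq k i.+1) => [->|ne]; first by rewrite hi.
    by have := jmin k.-1; rewrite prednK; lia.
  exists (Ordinal j2n); apply: PA => //=.
  by have := hlt j; have := hstep j j2n; lia.
have down_arc (j : 'I_(2 * n)) : h j = (h j.+1).+1 -> exists i, A i j.
  move=> hj.
  have [||i /andP[ij hi] imax] :=
    @ex_maxnP (fun i => (i <= j) && (h i <= h j.+1)) j.
  - by exists 0; rewrite h0.
  - by move=> i /andP[].
  have hlt k : i < k <= j -> h j.+1 < h k.
    by move=> /andP[ik kj]; have := imax k; lia.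
  have i2n : i < 2 * n by apply: leq_ltn_trans (ltn_ord j).
  have ltij : i < j by case: (eqVneq i (j : nat)) hi hj => [->|]; lia.
  have hij : h i = h j.+1.
    by have := hlt i.+1; have := hstep i i2n; lia.
  exists (Ordinal i2n); apply: PA => //= k; rewrite hij; exact: hlt.
have ma : is_matching a.
  apply/and3P; split; first (apply/and3P; split).
  - apply/eqP/finset.setP => x; rewrite inE; apply/finset.bigcupP.
    have [/up_arc[j Axj]|/down_arc[i Aix]] := hstep x (ltn_ord x).
      by exists [set x; j]%SET; [apply/aP; exists x, j | rewrite !inE eqxx].
    by exists [set i; x]%SET; [apply/aP; exists i, x | rewrite !inE eqxx orbT].
  - apply/finset.trivIsetP => _ _ /aP[i [j [Aij ->]]] /aP[i' [j' [Aij' ->]]].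
    apply: contraR => /pred0Pn[x /= /andP[xi xi']].
    by have [-> ->] := Ainj _ _ _ _ _ Aij Aij' xi xi'.
  - apply/aP => - [i [j [_ /finset.setP/(_ i)]]]; by rewrite !inE eqxx.
  - apply/forall_inP => _ /aP[i [j [/AP[ij _ _] ->]]].
    by rewrite cards2 neq_ltn ij.
  - apply/existsP => - [i /existsP[j /existsP[k /existsP[l]]]].
    case/and4P => /andP[ij jk] kl ika jla.
    have /AP[_ hik Hik] := aA _ _ (ltn_trans ij jk) ika.
    have /AP[_ hjl Hjl] := aA _ _ (ltn_trans jk kl) jla.
    have := Hik j; have := Hjl k.+1; lia.
exists (exist _ a ma) => i j /andP[ij ija].
by have /AP[] := aA _ _ ij ija.
Qed.

End DyckPath.

(** * Linear algebra of the nilpotent map *)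

(** Linear arithmetic over dimensions.  The same dimension can occur with
    convertible but syntactically different structure arguments; abstracting
    it up to conversion makes it a single unknown. *)
Ltac dimlia :=
  repeat match goal with H : context [@dimv _ _ _] |- _ => move: H end;
  repeat match goal with |- context [@dimv ?K ?V ?U] =>
    move: (@dimv K V U : nat) => ? end; lia.

Section LinearAlgebra.
Variables (C : numClosedFieldType) (N : nat).
Notation E := 'rV[C]_(N + N).
Local Notation zp := (zpow C N).
Local Notation S := (shift_mx C N).

Lemma zpow_row_mx d (a b : 'rV[C]_N) :
  zp d (row_mx a b) = row_mx (a *m S ^+ d) (b *m S ^+ d).
Proof. by rewrite zpowE iter_zE z_mxX mul_row_block !mulmx0 addr0 add0r. Qed.

Lemma shift_coord d (a : 'rV[C]_N) (i j : 'I_N) : i = (j + d)%N :> nat ->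
  (a *m S ^+ d) 0 j = a 0 i.
Proof.
move=> ij; rewrite mxE (bigD1 i) //= shift_mxX ij eqxx mulr1 big1 ?addr0 //.
by move=> k; rewrite -val_eqE /= ij shift_mxX => /negPf->; rewrite mulr0.
Qed.

(** The shift is a partial isometry: its adjoint undoes it on the vectors whose
    first d coordinates, those that are shifted out, vanish. *)
Lemma shift_adjK d (a : 'rV[C]_N) : (forall i : 'I_N, (i < d)%N -> a 0 i = 0) ->
  a *m S ^+ d *m map_mx Num.conj (S ^+ d)^T = a.
Proof.
move=> a0; apply/rowP => i; rewrite mxE; case: (ltnP i d) => id.
  rewrite a0 // big1 // => k _; rewrite !mxE shift_mxX.
  by have /negPf-> : i != (k + d)%N :> nat; [lia | rewrite conjC0 mulr0].
have lt : (i - d < N)%N by have := ltn_ord i; lia.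
rewrite (bigD1 (Ordinal lt)) //= (@shift_coord d a i) /=; last lia.
rewrite !mxE shift_mxX /= subnK // eqxx conjC1 mulr1 big1 ?addr0 // => k.
rewrite -val_eqE /= => ki; rewrite !mxE shift_mxX.
by have /negPf-> : i != (k + d)%N :> nat; [lia | rewrite conjC0 mulr0].
Qed.

(** On the summands of E the map C takes the sum of the coordinates, which is
    unaffected if only vanishing coordinates are shifted out. *)
Lemma shift_sum d (a : 'rV[C]_N) p (r : 'rV[C]_p) :
    (forall i : 'I_N, (i < d)%N -> a 0 i = 0) ->
  a *m S ^+ d *m (\matrix_(i < N) r) = a *m (\matrix_(i < N) r).
Proof.
move=> a0; rewrite -mulmxA; apply/rowP => j; rewrite !mxE.
apply: eq_bigr => i _; case: (ltnP i d) => id; first by rewrite a0 // !mul0r.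
have lt : (i - d < N)%N by have := ltn_ord i; lia.
rewrite !mxE (bigD1 (Ordinal lt)) //= shift_mxX /= subnK // eqxx mul1r mxE.
rewrite big1 ?addr0 // => k; rewrite -val_eqE /= => ki; rewrite shift_mxX.
by have /negPf-> : i != (k + d)%N :> nat; [lia | rewrite mul0r].
Qed.

Lemma dotmx_delta k (v : 'rV[C]_k) i : dotmx v (delta_mx 0 i) = v 0 i.
Proof.
rewrite dotmxE mxE (bigD1 i) //= !mxE !eqxx conjC1 mulr1 big1 ?addr0 // => j ji.
by rewrite !mxE eqxx (negPf ji) conjC0 mulr0.
Qed.

Lemma zpow_ef (i : 'I_N) d :
  (i < d)%N -> zp d (e C i) = 0 /\ zp d (f C i) = 0.
Proof.
have [m] := ubnP (i : nat); elim: m i d => // m IH i [//|d] im id.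
rewrite !zpowE !iterSr.
case: (eqVneq (i : nat) 0%N) => [i0|i0].
  by rewrite z_e0 // z_f0 // -!zpowE !linear0.
have lt : (i.-1 < N)%N by have := ltn_ord i; lia.
rewrite (@z_e _ _ i (Ordinal lt)) /=; last lia.
rewrite (@z_f _ _ i (Ordinal lt)) /=; last lia.
rewrite -!zpowE; apply: IH => /=; lia.
Qed.

Lemma perp_lker_coord d v (i : 'I_N) : v \in perp (lker (zp d)) -> (i < d)%N ->
  v 0 (lshift N i) = 0 /\ v 0 (rshift N i) = 0.
Proof.
move=> /mem_perp vk /zpow_ef[ei fi]; split; rewrite -dotmx_delta; apply: vk.
  by rewrite memv_ker -/(e C i) ei.
by rewrite memv_ker -/(f C i) fi.
Qed.

Lemma perp_lker_row d v : v \in perp (lker (zp d)) ->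
  exists a b : 'rV[C]_N, [/\ v = row_mx a b,
    forall i : 'I_N, (i < d)%N -> a 0 i = 0 &
    forall i : 'I_N, (i < d)%N -> b 0 i = 0].
Proof.
move=> vk; exists (lsubmx v), (rsubmx v); split; first by rewrite hsubmxK.
  by move=> i id; rewrite mxE; case: (perp_lker_coord vk id).
by move=> i id; rewrite mxE; case: (perp_lker_coord vk id).
Qed.

Lemma zpow_isometry d v u : v \in perp (lker (zp d)) ->
  dotmx (zp d v) (zp d u) = dotmx v u.
Proof.
case/perp_lker_row => a [b [-> a0 b0]]; rewrite -[u in LHS]hsubmxK !zpow_row_mx.
rewrite !dotmxE !tr_row_mx !map_col_mx !mul_row_col -[u in RHS]hsubmxK.
rewrite !tr_row_mx !map_col_mx !mul_row_col !trmx_mul !map_mxM !mulmxA.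
by rewrite !shift_adjK.
Qed.

Lemma Cmap_zpow d v : v \in perp (lker (zp d)) ->
  Cmap C N (zp d v) = Cmap C N v.
Proof.
case/perp_lker_row => a [b [-> a0 b0]]; rewrite zpow_row_mx !CmapE /C_mx.
by rewrite !mul_row_col !shift_sum.
Qed.

Lemma zpowS d v : zp d.+1 v = zp d (z C N v).
Proof. by rewrite !zpowE iterSr. Qed.

Lemma zpowSz d v : zp d.+1 v = z C N (zp d v).
Proof. by rewrite !zpowE iterS. Qed.

Lemma zpowD c d v : zp (c + d) v = zp c (zp d v).
Proof. by rewrite !zpowE iterD. Qed.

Lemma zpow1 : zp 1 = z C N. Proof. by apply/lfunP => v; rewrite zpowE. Qed.

Lemma row_sum_ef (v : E) :
  v = \sum_(i < N) (v 0 (lshift N i) *: e C i + v 0 (rshift N i) *: f C i).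
Proof.
by rewrite [LHS]row_sum_delta big_split_ord [RHS]big_split.
Qed.

Lemma Esub_lker k : Esub C N k = lker (zp k).
Proof.
apply/eqP; rewrite eqEsubv; apply/andP; split.
  apply/subv_sumP => i ik; have [ei fi] := zpow_ef ik.
  by rewrite subv_add -!memvE !memv_ker ei fi eqxx.
apply/subvP => v; rewrite memv_ker => /eqP vk; rewrite [v]row_sum_ef.
apply: rpred_sum => i _; case: (ltnP i k) => ik.
  apply: (subvP (sumv_sup i ik (subvv _))).
  by apply: memv_add; apply: memvZ; apply: memv_line.
have lt : (i - k < N)%N by have := ltn_ord i; lia.
move: vk; rewrite -[v]hsubmxK zpow_row_mx => /eqP.
rewrite -row_mx0 => /eqP/eq_row_mx.
move=> [/rowP/(_ (Ordinal lt)) vl /rowP/(_ (Ordinal lt)) vr].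
move: vl vr; rewrite !(@shift_coord k _ i) ?[RHS]mxE /=; try lia.
by rewrite !hsubmxK !mxE => -> ->; rewrite !scale0r addr0 mem0v.
Qed.

Lemma dim_Esub_le k : (k <= N)%N -> (\dim (Esub C N k) <= 2 * k)%N.
Proof.
move=> kN; apply: leq_trans (dimv_leq_sum _ _ _) _.
apply: (@leq_trans (\sum_(i < N | (i < k)%N) 2)).
  apply: leq_sum => i _; apply: leq_trans (leq_of_leqif (dimv_add_leqif _ _)) _.
  by rewrite !dim_vline; case: eqP; case: eqP.
by rewrite -(big_ord_widen N (fun=> 2%N) kN) sum_nat_const card_ord mulnC.
Qed.

Lemma limg_zpow_sub d : (d <= N)%N -> (limg (zp d) <= lker (zp (N - d)))%VS.
Proof.
move=> dN; apply/subvP => _ /memv_imgP[v _ ->].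
by rewrite memv_ker -zpowD subnK // zpowE iter_z_nilp.
Qed.

Lemma dim_lker_limg (g : 'End(E)) :
  (\dim (lker g) + \dim (limg g) = 2 * N)%N.
Proof.
by rewrite -[lker g]capfv limg_ker_dim dimvf /dim /= mul1n mul2n addnn.
Qed.

(** The upper bound comes from the spanning vectors of E_d.  It bounds the image
    of z^d too, as this lies in ker z^(N - d), and so yields the lower bound
    by rank-nullity. *)
Lemma dim_lker d : (d <= N)%N -> \dim (lker (zp d)) = (2 * d)%N.
Proof.
move=> dN; apply/eqP; rewrite eqn_leq -{1}Esub_lker dim_Esub_le //=.
have := dim_lker_limg (zp d).
have := dimvS (limg_zpow_sub dN); have := dim_Esub_le (leq_subr d N).
rewrite Esub_lker; dimlia.
Qed.

Lemma limg_zpow d : (d <= N)%N -> limg (zp d) = lker (zp (N - d)).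
Proof.
move=> dN; apply/eqP; rewrite eqEdim limg_zpow_sub //=.
have := dim_lker_limg (zp d).
rewrite !dim_lker ?leq_subr //; dimlia.
Qed.

Lemma dim_lpreim (g : 'End(E)) W : (W <= limg g)%VS ->
  \dim (g @^-1: W) = (\dim (lker g) + \dim W)%N.
Proof.
move=> Wg; rewrite -(limg_ker_dim g) lpreimK //.
have -> // : (g @^-1: W :&: lker g)%VS = lker g.
apply/capv_idPr/subvP => v; rewrite memv_ker -memv_preim => /eqP->.
exact: mem0v.
Qed.

Definition stable (A : {vspace E}) := (z C N @: A <= A)%VS.

Lemma stable_lpreim A : stable A -> (A <= z C N @^-1: A)%VS.
Proof.
by move=> sA; apply/subvP => v vA; rewrite -memv_preim (subvP sA) ?memv_img.
Qed.

Lemma stable_iter A k v : stable A -> v \in A -> iter k (z C N) v \in A.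
Proof.
by move=> sA vA; elim: k => // k IH; rewrite iterS (subvP sA) ?memv_img.
Qed.

Lemma perp_disjoint k (U : {vspace 'rV[C]_k}) : (U :&: perp U = 0)%VS.
Proof.
apply/eqP; rewrite -subv0; apply/subvP => v.
rewrite memv_cap => /andP[vU /mem_perp/(_ v vU)/eqP].
by rewrite dnorm_eq0 memv0.
Qed.

Lemma add_cap_perp k (U V : {vspace 'rV[C]_k}) : (U <= V)%VS ->
  (U + (V :&: perp U))%VS = V.
Proof.
move=> UV; apply/eqP; rewrite eqEdim subv_add UV capvSl /=.
rewrite dimv_disjoint_sum ?dim_cap_perp //.
by apply/eqP; rewrite -subv0 -(perp_disjoint U) capvS ?capvSr.
Qed.

Lemma perpS k (U V : {vspace 'rV[C]_k}) : (U <= V)%VS -> (perp V <= perp U)%VS.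
Proof.
move=> /subvP UV; apply/subvP => v /mem_perp vV.
by apply/mem_perp => u /UV; apply: vV.
Qed.

(** The orthogonal complement of A in z^-1 A, which parametrizes the z-stable
    extensions of A by a line. *)
Definition slice A := (z C N @^-1: A :&: perp A)%VS.

(** The iterates of z map the slice into A, which is orthogonal to the slice. *)
Lemma slice_isometry A v w : stable A -> v \in slice A -> w \in slice A ->
  dotmx (Cmap C N v) (Cmap C N w) = dotmx v w.
Proof.
move=> sA; rewrite !memv_cap -!memv_preim.
move=> /andP[zv /mem_perp vA] /andP[zw /mem_perp wA].
apply: Cmap_isometry => k; first by apply: vA; rewrite iterSr stable_iter.
by apply/eqP; rewrite herm_eq0C; apply/eqP/wA; rewrite iterSr stable_iter.
Qed.

Lemma slice_ker A U : stable A -> (U <= slice A)%VS ->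
  (U :&: lker (Cmap C N) = 0)%VS.
Proof.
move=> sA /subvP UA; apply/eqP; rewrite -subv0; apply/subvP => v.
rewrite memv_cap memv_ker => /andP[/UA vA /eqP Cv].
have := slice_isometry sA vA vA.
by rewrite Cv linear0l memv0 -(dnorm_eq0 (@dotmx C _)) /= => <-.
Qed.

Lemma slice_inj A U V : stable A -> (U <= slice A)%VS -> (V <= slice A)%VS ->
  (Cmap C N @: U <= Cmap C N @: V)%VS -> (U <= V)%VS.
Proof.
move=> sA UA VA /subvP CUV; apply/subvP => u uU.
have /memv_imgP[v vV Cuv] := CUV _ (memv_img (Cmap C N) uU).
suff -> : u = v by [].
apply/eqP; rewrite -subr_eq0 -memv0 -(slice_ker sA (subvv _)) memv_cap.
rewrite memv_ker linearB /= Cuv subrr eqxx andbT rpredB //.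
  exact: (subvP UA).
exact: (subvP VA).
Qed.

Lemma sub_limg_zpow d k (A : {vspace E}) :
  (A <= lker (zp k))%VS -> (k + d <= N)%N -> (A <= limg (zp d))%VS.
Proof.
move=> Ak kd; rewrite limg_zpow; last by lia.
apply: subv_trans Ak _; apply/subvP => v; rewrite !memv_ker => /eqP vk.
have -> : (N - d = (N - d - k) + k)%N by lia.
by rewrite zpowD vk linear0.
Qed.

Lemma dim_lpreim_zpow d k A : (A <= lker (zp k))%VS -> (k + d <= N)%N ->
  \dim (zp d @^-1: A) = (2 * d + \dim A)%N.
Proof.
move=> Ak kd; rewrite dim_lpreim ?dim_lker //; first lia.
exact: sub_limg_zpow Ak kd.
Qed.

Lemma dim_slice k A : stable A -> (A <= lker (zp k))%VS -> (k < N)%N ->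
  \dim (slice A) = 2%N.
Proof.
move=> sA Ak kN; have := dim_cap_perp (stable_lpreim sA).
have := @dim_lpreim_zpow 1 _ _ Ak; rewrite zpow1 addn1 => /(_ kN) ->.
by rewrite -/(slice A); dimlia.
Qed.

Lemma Cmap_slice k A : stable A -> (A <= lker (zp k))%VS -> (k < N)%N ->
  (Cmap C N @: slice A)%VS = fullv.
Proof.
move=> sA Ak kN; apply/eqP; rewrite eqEdim subvf /=.
by rewrite limg_dim_eq ?(dim_slice sA Ak) ?dimvf ?(slice_ker sA).
Qed.

(** Both sides are lines; C preserves the orthogonality of the two lines that B
    determines in the slice of A, namely B :&: A^perp and its complement. *)
Lemma Cmap_lpreim_perp A B :
    stable A -> (A <= B)%VS -> (B <= z C N @^-1: A)%VS ->
    \dim B = (\dim A).+1 -> \dim (z C N @^-1: A) = (\dim A).+2 ->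
  (Cmap C N @: (z C N @^-1: A :&: perp B) =
   perp (Cmap C N @: (B :&: perp A)))%VS.
Proof.
move=> sA AB BzA dB dz; apply/eqP; rewrite eqEdim; apply/andP; split.
  apply/subvP => _ /memv_imgP[v vz ->]; apply/mem_perp => _ /memv_imgP[w wB ->].
  have vB : v \in perp B by move: vz; rewrite memv_cap => /andP[].
  rewrite (@slice_isometry A) //; last exact: (subvP (capvS BzA (subvv _))).
    by move/mem_perp: vB; apply; move: wB; rewrite memv_cap => /andP[].
  by apply: (subvP (capvS (subvv _) (perpS AB))).
rewrite limg_dim_eq; last by apply: (slice_ker sA); rewrite capvS ?perpS.
have dl : \dim (Cmap C N @: (B :&: perp A))%VS = 1%N.
  rewrite limg_dim_eq; first by have := dim_cap_perp AB; dimlia.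
  by apply: (slice_ker sA); rewrite capvS.
have := dim_cap_perp (subvf (Cmap C N @: (B :&: perp A))%VS).
rewrite capfv dimvf /dim /= dl.
have := dim_cap_perp BzA; dimlia.
Qed.

(** The case of two adjacent points.  The lines of M and of z^-1 A over B lie in
    the slice of B, where C is injective, and the second one has the image
    computed in [Cmap_lpreim_perp]. *)
Lemma eq_lpreim_line A B M :
    stable A -> (A <= B)%VS -> (B <= z C N @^-1: A)%VS ->
    \dim B = (\dim A).+1 -> \dim (z C N @^-1: A) = (\dim A).+2 ->
    (B <= M)%VS -> (z C N @: M <= B)%VS ->
  M = (z C N @^-1: A)%VS <->
  (Cmap C N @: (M :&: perp B) = perp (Cmap C N @: (B :&: perp A)))%VS.
Proof.
move=> sA AB BzA dB dz BM zM; rewrite -Cmap_lpreim_perp //; split=> [->//|CM].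
have sB : stable B by apply: subv_trans zM; apply: limgS.
have M1 : (M :&: perp B <= slice B)%VS.
  apply: capvS => //; apply/subvP => v vM.
  by rewrite -memv_preim (subvP zM) ?memv_img.
have M2 : (z C N @^-1: A :&: perp B <= slice B)%VS by rewrite capvS ?lpreimS.
rewrite -(add_cap_perp BM) -(add_cap_perp BzA); congr (_ + _)%VS.
apply/eqP; rewrite eqEsubv.
by apply/andP; split; apply: (slice_inj sB); rewrite ?CM.
Qed.

(** The space P :&: Q^perp, with Q = z^-d B, is orthogonal to ker z^d, since Q
    contains this kernel.  There z^d is isometric and does not change the
    value of C. *)
Lemma zpow_transport d B P : (B <= limg (zp d))%VS ->
    (zp d @^-1: B <= P)%VS -> (z C N @: P <= zp d @^-1: B)%VS ->
    \dim P = (\dim (zp d @^-1: B)).+1 -> stable B ->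
  [/\ (B <= zp d @: P)%VS, (z C N @: (zp d @: P) <= B)%VS,
    \dim (zp d @: P) = (\dim B).+1
   & Cmap C N @: (P :&: perp (zp d @^-1: B)) =
     Cmap C N @: (zp d @: P :&: perp B)]%VS.
Proof.
move=> Bd QP zP dP sB; have BdP : (B <= zp d @: P)%VS.
  by rewrite -(lpreimK Bd) limgS.
have zdP : (z C N @: (zp d @: P) <= B)%VS.
  apply/subvP => _ /memv_imgP[_ /memv_imgP[v vP ->] ->].
  rewrite -zpowSz zpowS memv_preim (subvP zP) ?memv_img //.
have kQ : (lker (zp d) <= zp d @^-1: B)%VS.
  by apply/subvP => v; rewrite memv_ker -memv_preim => /eqP->; rewrite mem0v.
have dM : (\dim (zp d @: P) = (\dim B).+1)%N.
  have := limg_ker_dim (zp d) P.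
  rewrite dP dim_lpreim // (capv_idPr (subv_trans kQ QP)).
  by dimlia.
split=> //; apply/eqP; rewrite eqEdim; apply/andP; split.
  apply/subvP => _ /memv_imgP[v + ->]; rewrite memv_cap => /andP[vP vQ].
  have vk : v \in perp (lker (zp d)) by apply: (subvP (perpS kQ)).
  rewrite -(Cmap_zpow vk) memv_img // memv_cap memv_img //=; apply/mem_perp.
  move=> u uB; move: (uB); rewrite -(lpreimK Bd) => /memv_imgP[w wQ ->].
  by rewrite zpow_isometry //; move/mem_perp: vQ; apply.
have := dim_cap_perp QP; have := dim_cap_perp BdP; rewrite dM dP => h1 h2.
have sQ : stable (zp d @^-1: B) by apply: subv_trans zP; apply: limgS.
have sub_slice U V : (z C N @: V <= U)%VS -> (V :&: perp U <= slice U)%VS.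
  move=> zV; apply: capvS => //; apply/subvP => v vV.
  by rewrite -memv_preim (subvP zV) ?memv_img.
rewrite (limg_dim_eq (slice_ker sQ (sub_slice _ _ zP))).
rewrite (limg_dim_eq (slice_ker sB (sub_slice _ _ zdP))).
dimlia.
Qed.
End LinearAlgebra.

(** * Flags and the arc conditions *)
Section Flags.
Variables (C : numClosedFieldType) (N : nat).
Local Notation zp := (zpow C N).
Local Notation z := (z C N).
Local Notation Cmap := (Cmap C N).
Notation E := 'rV[C]_(N + N).

Lemma lpreim_zpowS d (A : {vspace E}) :
  (zp d.+1 @^-1: A = zp d @^-1: (z @^-1: A))%VS.
Proof. by apply/vspaceP => v; rewrite -!memv_preim zpowSz. Qed.

Lemma lpreim_zpowD c d (A : {vspace E}) :
  (zp (c + d) @^-1: A = zp d @^-1: (zp c @^-1: A))%VS.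
Proof. by apply/vspaceP => v; rewrite -!memv_preim zpowD. Qed.

Lemma lpreim_zpow0 (A : {vspace E}) : (zp 0 @^-1: A)%VS = A.
Proof. by apply/vspaceP => v; rewrite -!memv_preim zpowE. Qed.

Lemma lker_zpowS d : lker (zp d.+1) = (z @^-1: lker (zp d))%VS.
Proof. by apply/vspaceP => v; rewrite -memv_preim !memv_ker zpowS. Qed.

Lemma sub_lpreimE (g : 'End(E)) U W : (U <= g @^-1: W)%VS = (g @: U <= W)%VS.
Proof.
apply/subvP/subvP => [UW _ /memv_imgP[u /UW + ->]|UW u uU].
  by rewrite -memv_preim.
by rewrite -memv_preim UW ?memv_img.
Qed.

Section OneFlag.
Variables (m : nat) (L : Y C N m).
Local Notation st := (step (val L)).

Definition flag_line k := (Cmap @: (st k.+1 :&: perp (st k)))%VS.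

Lemma val_phi (i : 'I_m) : val (tnth (phi L) i) = flag_line i.
Proof. by rewrite tnth_mktuple. Qed.

Lemma step0 : st 0 = 0%VS. Proof. by []. Qed.

Lemma step_dim k : (k <= m)%N -> \dim (st k) = k.
Proof.
by case: k => [|k] km; [rewrite dimv0 | rewrite (flag_dim L (Ordinal km))].
Qed.

Lemma step_subS k : (k < m)%N -> (st k <= st k.+1)%VS.
Proof. by move=> km; apply: (flag_sub L (Ordinal km)). Qed.

Lemma step_z k : (k < m)%N -> (z @: st k.+1 <= st k)%VS.
Proof. by move=> km; apply: (flag_z_sub L (Ordinal km)). Qed.

Lemma step_stable k : (k <= m)%N -> stable (st k).
Proof.
case: k => [|k] km; first by rewrite /stable step0 limg0.
exact: (flag_stable L (Ordinal km)).
Qed.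

Lemma step_lker k : (k <= m)%N -> (st k <= lker (zp k))%VS.
Proof.
elim: k => [|k IH] km; first by rewrite step0 sub0v.
rewrite lker_zpowS sub_lpreimE.
exact: subv_trans (step_z km) (IH (ltnW km)).
Qed.

Lemma step_sub j k : (j <= k)%N -> (k <= m)%N -> (st j <= st k)%VS.
Proof.
elim: k => [|k IH]; first by rewrite leqn0 => /eqP->.
rewrite leq_eqVlt => /predU1P[-> //|jk] km.
exact: subv_trans (IH jk (ltnW km)) (step_subS km).
Qed.

Lemma dim_lpreim_step d k : (k <= m)%N -> (k + d <= N)%N ->
  \dim (zp d @^-1: st k) = (2 * d + k)%N.
Proof.
move=> km kd; rewrite (dim_lpreim_zpow (step_lker km)) // step_dim //.
Qed.

(** The arc condition, read as a relation between arbitrary positions of the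
    flag and with d existentially quantified, which makes it reflexive and
    transitive. *)
Definition linked p q :=
  exists d, q = (p + 2 * d)%N /\ st q = (zp d @^-1: st p)%VS.

Lemma linked_refl p : linked p p.
Proof. by exists 0%N; rewrite addn0 lpreim_zpow0. Qed.

Lemma linked_trans p q r : linked p q -> linked q r -> linked p r.
Proof.
move=> [c [qE sq]] [d [rE sr]]; exists (c + d)%N.
by rewrite sr sq lpreim_zpowD; split=> //; lia.
Qed.

Hypothesis mN : (m <= N)%N.

(** Applying z^d moves the step of the flag at j down to a step over L_(i+1),
    which then has to be compared with z^-1 L_i. *)
Lemma linked_arcP i d (j := (i.+1 + 2 * d)%N) : (j < m)%N ->
    st j = (zp d @^-1: st i.+1)%VS ->
  [/\ (st i.+1 <= zp d @: st j.+1)%VS, (z @: (zp d @: st j.+1) <= st i.+1)%VS,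
      \dim (zp d @: st j.+1)%VS = i.+2,
      flag_line j = (Cmap @: (zp d @: st j.+1 :&: perp (st i.+1)))%VS &
      (st j.+1 = (zp d.+1 @^-1: st i)%VS <->
       (zp d @: st j.+1)%VS = (z @^-1: st i)%VS)].
Proof.
move=> jm sj; have im : (i.+1 < m)%N by move: jm; rewrite /j; lia.
have jN : (j < N)%N by lia.
have Bd : (st i.+1 <= limg (zp d))%VS.
  by apply: sub_limg_zpow (step_lker (ltnW im)) _; move: jN; rewrite /j; lia.
have QP := step_subS jm; have zP := step_z jm; rewrite sj in QP zP.
have dP : \dim (st j.+1) = (\dim (zp d @^-1: st i.+1)).+1.
  by rewrite -sj !step_dim // ltnW.
have [BM zM dM lineE] := zpow_transport Bd QP zP dP (step_stable (ltnW im)).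
split=> //; [by rewrite dM step_dim // ltnW | by rewrite /flag_line sj |].
rewrite lpreim_zpowS; split=> [->|ME].
  rewrite lpreimK //; apply: (@sub_limg_zpow _ _ d i.+1); last first.
    by move: jN; rewrite /j; lia.
  by rewrite lker_zpowS lpreimS // step_lker; lia.
apply/eqP; rewrite eqEdim sub_lpreimE ME subvv /= -lpreim_zpowS dim_lpreim_step.
- by rewrite step_dim // /j; lia.
- by lia.
- by move: jN; rewrite /j; lia.
Qed.

(** Under the conditions of the arcs below (i, j), the condition of this arc is
    orthogonality of two lines. *)
Lemma linked_arc i j : (j < m)%N -> linked i.+1 j ->
  linked i j.+1 <-> flag_line j = perp (flag_line i).
Proof.
move=> + [d [jE sj]]; rewrite jE in sj *; move: {j jE}sj => sj jm.
have [BM zM _ -> E2] := linked_arcP jm sj.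
have im : (i.+1 < m)%N by move: jm; lia.
have dz := @dim_lpreim_step 1 i; rewrite zpow1 in dz.
have := @eq_lpreim_line C N (st i) (st i.+1) (zp d @: st (i.+1 + 2 * d).+1)%VS.
move=> [] //; try by rewrite ?sub_lpreimE ?step_z ?step_subS //; lia.
- by apply: step_stable; lia.
- by rewrite !step_dim //; lia.
- by rewrite dz ?step_dim //; lia.
move=> H1 H2; rewrite -/(flag_line i) in H1 H2.
split=> [[d' [dE sd]]|/H2/E2 sE]; last by exists d.+1; split=> //; lia.
have ? : d' = d.+1 by lia.
by apply/H1/E2; subst d'.
Qed.

End OneFlag.
End Flags.

(** * The sets K_a cover the Springer variety *)
Section Fung.
Variables (C : numClosedFieldType) (N : nat).
Local Notation zp := (zpow C N).
Local Notation z := (z C N).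
Notation E := 'rV[C]_(N + N).

(** The size of the smaller Jordan block of z on U, for a z-stable U.  The
    bound N + 1 only makes the range finite: the values for b > N would not
    give larger kernels. *)
Definition depth (U : {vspace E}) : nat :=
  [arg max_(b > ord0 : 'I_N.+1 | (lker (zp b) <= U)%VS) (b : nat)].

Lemma depthP U :
  [/\ (lker (zp (depth U)) <= U)%VS, (depth U <= N)%N &
   forall b, (b <= N)%N -> (lker (zp b) <= U)%VS -> (b <= depth U)%N].
Proof.
rewrite /depth; case: arg_maxnP => [|b bU bmax].
  by apply/subvP => v; rewrite memv_ker zpowE /= => /eqP->; rewrite mem0v.
split=> // [|c cN cU]; first by rewrite -ltnS.
by have := bmax (Ordinal (cN : c < N.+1)%N); apply.
Qed.

Lemma limg_z_lker b : (b < N)%N -> (z @: lker (zp b.+1) = lker (zp b))%VS.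
Proof.
move=> bN; rewrite lker_zpowS lpreimK // -zpow1.
by apply: (@sub_limg_zpow _ _ 1 b); rewrite ?addn1.
Qed.

Lemma limg_zpow_lker b d : (b + d <= N)%N ->
  (zp d @: lker (zp (b + d)) = lker (zp b))%VS.
Proof.
move=> bd; have -> : lker (zp (b + d)) = (zp d @^-1: lker (zp b))%VS.
  by apply/vspaceP => v; rewrite -memv_preim !memv_ker zpowD.
by rewrite lpreimK // (sub_limg_zpow (subvv _)).
Qed.

Lemma lker_zpow_sub b c : (b <= c)%N -> (lker (zp b) <= lker (zp c))%VS.
Proof.
move=> bc; apply/subvP => v; rewrite !memv_ker => /eqP vb.
by rewrite -(subnK bc) zpowD vb linear0.
Qed.

(** Passing from A to B enlarges the larger Jordan block, and passing from B to
    M the smaller one, of size b.  Then A = z B + ker z^b: the left-hand side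
    contains the right-hand side, which has dimension at least dim B - 1,
    because B does not contain ker z^(b+1).  Both summands lie in z M, whose
    dimension is that of A. *)
Lemma limg_z_closing b A B M : (b < N)%N ->
    (z @: B <= A)%VS -> (z @: M <= B)%VS -> (A <= B)%VS -> (B <= M)%VS ->
    \dim B = (\dim A).+1 -> \dim M = (\dim A).+2 ->
    (lker (zp b) <= A)%VS -> ~~ (lker (zp b.+1) <= B)%VS ->
    (lker (zp b.+1) <= M)%VS ->
  (z @: M = A)%VS.
Proof.
move=> bN zB zM AB BM dB dM bA bB bM; apply/esym/eqP.
have kM : (lker z <= M)%VS.
  by rewrite -zpow1; apply: subv_trans bM; apply: lker_zpow_sub.
have dk : \dim (lker z) = 2%N by rewrite -zpow1 dim_lker //; lia.
have dzM : \dim (z @: M) = \dim A.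
  by have := limg_ker_dim z M; rewrite (capv_idPr kM) dk; dimlia.
rewrite eqEdim dzM leqnn andbT.
have defA : (z @: B + lker (zp b))%VS = A.
  apply/eqP; rewrite eqEdim subv_add zB bA /=.
  have dzB := limg_ker_dim z B.
  have dcap : (\dim (B :&: lker z) <= 2)%N by rewrite -dk dimvS ?capvSr.
  case: b bN bB bA {bM} => [|b] bN bB bA.
    have : (\dim (B :&: lker z) != 2)%N.
      apply: contra bB => /eqP d2; rewrite zpow1.
      have /eqP <- : (B :&: lker z == lker z)%VS by rewrite eqEdim capvSr dk d2.
      exact: capvSl.
    by have := dimvS (addvSl (z @: B)%VS (lker (zp 0))); dimlia.
  suff : (\dim (z @: B) < \dim (z @: B + lker (zp b.+1)))%N by dimlia.
  rewrite ltnNge; apply: contra bB => dle; apply/subvP => v.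
  have bzB : (lker (zp b.+1) <= z @: B)%VS.
    have /eqP-> : (z @: B == z @: B + lker (zp b.+1))%VS.
      by rewrite eqEdim addvSl.
    exact: addvSr.
  rewrite lker_zpowS -memv_preim => /(subvP bzB)/memv_imgP[u uB zvu].
  rewrite -(subrK u v) rpredD // (subvP (subv_trans bA AB)) //.
  by rewrite memv_ker zpowS linearB /= zvu subrr linear0.
rewrite -defA subv_add limgS //= -(limg_z_lker bN) limgS //.
Qed.

Section OneFlag.
Variables (m : nat) (L : Y C N m).
Hypothesis mN : (m <= N)%N.
Local Notation st := (step (val L)).
Local Notation b k := (depth (st k)).

(** The difference of the sizes of the Jordan blocks of z on L_k. *)
Definition height k := (k - 2 * b k)%N.

Lemma depth_le k : (k <= m)%N -> (2 * b k <= k)%N.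
Proof.
move=> km; have [bU bN _] := depthP (st k).
by have := dimvS bU; rewrite dim_lker // (step_dim L).
Qed.

(** If L_(k+1) contains ker z^(c+1), then z L_(k+1), hence L_k, contains
    ker z^c. *)
Lemma depth_step k : (k < m)%N -> (b k <= b k.+1 <= (b k).+1)%N.
Proof.
move=> km; have [bU bN bmax] := depthP (st k).
have [bU' bN' bmax'] := depthP (st k.+1); apply/andP; split.
  by apply: bmax' => //; apply: subv_trans bU (step_subS L km).
case eb: (b k.+1) bU' bN' => [//|c] cU cN; apply: bmax; first exact: ltnW.
by rewrite -(limg_z_lker cN); apply: subv_trans (limgS _ cU) (step_z L km).
Qed.

Lemma height_step k : (k < m)%N ->
  height k.+1 = (height k).+1 \/ height k = (height k.+1).+1.
Proof.
move=> km; have := depth_step km; have := depth_le km.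
by have := depth_le (ltnW km); rewrite /height; lia.
Qed.

(** By the heights, the smaller block does not grow from L_i to L_(i+1), and in
    L_(j+1) it is larger by d + 1 than in L_i.  After transport by z^d this is
    the situation of [limg_z_closing]. *)
Lemma linked_first_return i j : (i < j < m)%N -> (height i < height i.+1)%N ->
  height i = height j.+1 -> linked L i.+1 j -> linked L i j.+1.
Proof.
move=> /andP[ij jm] hi hj [d [jE sj]]; exists d.+1; split; first by lia.
have im : (i < m)%N by apply: ltn_trans jm.
have im' : (i.+1 < m)%N by apply: leq_ltn_trans jm.
have [bi _ _] := depthP (st i); have [_ _ bmax] := depthP (st i.+1).
have [bj bjN _] := depthP (st j.+1).
have := depth_step im; have := depth_le (ltnW im); have := depth_le im.
move: hi hj; have := depth_le jm; rewrite /height => h1 h2 h3 h4 h5 h6.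
have bjE : b j.+1 = ((b i).+1 + d)%N by lia.
have biE : b i.+1 = b i by lia.
move: bj bjN; rewrite bjE => bj bjN.
subst j; have [BM zM dM _ ->] := linked_arcP mN jm sj.
have bM : (lker (zp (b i).+1) <= zp d @: st (i.+1 + 2 * d).+1)%VS.
  by rewrite -(limg_zpow_lker bjN) limgS.
have bN : (b i < N)%N by lia.
have zMA : (z @: (zp d @: st (i.+1 + 2 * d).+1))%VS = st i.
  apply: (limg_z_closing bN _ zM _ BM) => //.
  - exact: step_z.
  - exact: step_subS.
  - by rewrite !step_dim // ltnW.
  - by rewrite dM step_dim // ltnW.
  - by apply/negP => /bmax; rewrite biE ltnn; move/(_ bN).
apply/eqP; rewrite eqEdim sub_lpreimE zMA subvv /= dM -zpow1.
by rewrite dim_lpreim_step; lia.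
Qed.

End OneFlag.
End Fung.

(** * Surjectivity of phi *)
Section Surjectivity.
Variables (C : numClosedFieldType) (N : nat).
Local Notation zp := (zpow C N).
Local Notation z := (z C N).
Local Notation Cmap := (Cmap C N).
Notation E := 'rV[C]_(N + N).

Definition line_lift (A : {vspace E}) (l : {vspace 'rV[C]_2}) :=
  (slice A :&: Cmap @^-1: l)%VS.

(** C maps the slice of L_k isomorphically onto C^2, so that L_(k+1) can be
    recovered from L_k and the line l k. *)
Fixpoint flag_of (l : nat -> {vspace 'rV[C]_2}) k : {vspace E} :=
  if k is k'.+1 then (flag_of l k' + line_lift (flag_of l k') (l k'))%VS
  else 0%VS.

Lemma line_liftP k A l : stable A -> (A <= lker (zp k))%VS -> (k < N)%N ->
  (Cmap @: line_lift A l = l)%VS /\ \dim (line_lift A l) = \dim l.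
Proof.
move=> sA Ak kN; have Cl : (Cmap @: line_lift A l = l)%VS.
  apply/eqP; rewrite eqEsubv; apply/andP; split.
    apply/subvP => _ /memv_imgP[v + ->].
    by rewrite memv_cap -memv_preim => /andP[].
  apply/subvP => w wl; have : w \in (Cmap @: slice A)%VS.
    by rewrite (Cmap_slice sA Ak kN) memvf.
  case/memv_imgP => v vA wE; rewrite wE memv_img // memv_cap vA -memv_preim.
  by rewrite -wE.
by split=> //; rewrite -{2}Cl limg_dim_eq // (slice_ker sA) ?capvSl.
Qed.

Lemma flag_ofP l k : (forall i, \dim (l i) = 1%N) -> (k <= N)%N ->
  [/\ \dim (flag_of l k) = k, (flag_of l k <= lker (zp k))%VS &
      stable (flag_of l k)].
Proof.
move=> l1; elim: k => [|k IH] kN.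
  by rewrite /= dimv0 sub0v /stable limg0 sub0v.
have [dF Fk sF] := IH (ltnW kN); have [_ dX] := line_liftP (l k) sF Fk kN.
have XzF : (line_lift (flag_of l k) (l k) <= z @^-1: flag_of l k)%VS.
  by apply: subv_trans (capvSl _ _) (capvSl _ _).
have zF : (z @: flag_of l k.+1 <= flag_of l k)%VS.
  by rewrite /= limgD subv_add -!sub_lpreimE (stable_lpreim sF).
split.
- rewrite /= dimv_disjoint_sum ?dF ?dX ?l1 ?addn1 //.
  apply/eqP; rewrite -subv0 -(perp_disjoint (flag_of l k)) capvS //.
  by apply: subv_trans (capvSl _ _) (capvSr _ _).
- by rewrite lker_zpowS sub_lpreimE (subv_trans zF).
- exact: subv_trans zF (addvSl _ _).
Qed.

Lemma flag_of_line l k : (forall i, \dim (l i) = 1%N) -> (k < N)%N ->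
  (Cmap @: (flag_of l k.+1 :&: perp (flag_of l k)) = l k)%VS.
Proof.
move=> l1 kN; have [dF Fk sF] := flag_ofP l1 (ltnW kN).
have [dF' _ _] := flag_ofP l1 kN.
have [CX dX] := line_liftP (l k) sF Fk kN; rewrite -[RHS]CX.
congr (_ @: _)%VS; apply/esym/eqP.
rewrite eqEdim; apply/andP; split.
  rewrite subv_cap addvSr /=.
  by apply: subv_trans (capvSl _ _) (capvSr _ _).
have := dim_cap_perp (addvSl (flag_of l k) (line_lift (flag_of l k) (l k))).
rewrite -/(flag_of l k.+1) dX l1 dF dF'; dimlia.
Qed.

Lemma phi_surj m (l : m.-tuple (P1 C)) : (m <= N)%N ->
  exists L : Y C N m, phi L = l.
Proof.
move=> mN; pose l' i :=
    (* beyond m, any line serves as a default *)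
    if insub i is Some j then val (tnth l j) else <[delta_mx 0%R 0%R]>%VS.
have l1 i : \dim (l' i) = 1%N.
  rewrite /l'; case: insubP => [j _ _|_]; first exact: (eqP (valP (tnth l j))).
  rewrite dim_vline; case: eqP => // /matrixP/(_ 0 0)/eqP.
  by rewrite !mxE /= oner_eq0.
pose L := [tuple flag_of l' j.+1 | j < m].
have stE k : (k <= m)%N -> step L k = flag_of l' k.
  case: k => [//|k] km; rewrite /step /=.
  have -> : k = Ordinal km by [].
  by rewrite -[LHS](tnth_nth 0%VS L) tnth_mktuple.
have Lf : is_flag L.
  apply/forallP => j; rewrite !stE //; last exact: ltnW.
  have [-> _ sF] := flag_ofP l1 (leq_trans (ltn_ord j) mN).
  by rewrite eqxx addvSl; exact: sF.
exists (exist _ L Lf); apply: eq_from_tnth => i; apply: val_inj.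
rewrite val_phi /flag_line /= !stE ?flag_of_line //; last exact: ltnW.
  by rewrite /l' valK.
exact: leq_trans (ltn_ord i) mN.
Qed.
End Surjectivity.

(** * Images of K_a and of the Springer variety *)
Section Main.
Variable (C : numClosedFieldType).

Lemma perpK (l : P1 C) : perp (perp (val l)) = val l.
Proof.
apply/esym/eqP; rewrite eqEdim (eqP (valP l)).
rewrite (eqP (valP (perp_line (perp_line l)))) leqnn andbT.
apply/subvP => v vl; apply/mem_perp => w /mem_perp/(_ v vl) wv.
by apply/eqP; rewrite herm_eq0C; apply/eqP.
Qed.

Lemma perp_lineK : involutive (@perp_line C).
Proof. by move=> l; apply/val_inj/perpK. Qed.

Lemma involK m : involutive (@invol C m).
Proof.
move=> l; apply: eq_from_tnth => i; rewrite !tnth_mktuple.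
by case: odd => //; rewrite perp_lineK.
Qed.

Variables (N n : nat) (hN : (2 * n <= N)%N).
Implicit Type L : Y C N (2 * n).

Lemma Sset_line (a : matching n) L :
  Sset a (invol (phi L)) <->
  forall i j : 'I_(2 * n), arc a i j -> flag_line L j = perp (flag_line L i).
Proof.
have E (i j : 'I_(2 * n)) : odd j = ~~ odd i ->
    tnth (invol (phi L)) i = tnth (invol (phi L)) j <->
    flag_line L j = perp (flag_line L i).
  move=> oj; rewrite -!val_phi ![tnth (invol _) _]tnth_mktuple oj.
  case: (odd i) => /=; first by split=> [<-//|ij]; apply: val_inj.
  split=> [ ->|ij]; first by rewrite perpK.
  by apply: val_inj; rewrite /= ij perpK.
split=> [lS i j aij|lA i io].
  apply/E; rewrite ?(arc_odd aij) //.
  by rewrite (lS _ (arc_opening aij)) (arc_partner aij).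
have aij := opening_arc io; apply/E; first exact: arc_odd aij.
exact: lA.
Qed.

Lemma linked_springer L : linked L 0 (2 * n) <-> springer L.
Proof.
rewrite /springer /= Esub_lker; split=> [[d [dE ->]]|sE].
  have -> : d = n by lia.
  by rewrite step0 lpreim0.
by exists n; rewrite sE step0 lpreim0.
Qed.

(** Two differences to the definition of K_a are bridged here.  The preimages
    are taken in E instead of E_n, which is harmless because they have the
    dimension of L_(j+1), a subspace of E_n; and the condition L_(2n) = E_n is
    a consequence of the arc conditions. *)
Lemma Kset_linked (a : matching n) L :
  Kset a L <-> forall i j : 'I_(2 * n), arc a i j -> linked L i j.+1.
Proof.
have gapE (i j : 'I_(2 * n)) : arc a i j -> (2 * half_gap a i)%N = (j - i).+1.
  move=> aij; rewrite /half_gap (arc_partner aij).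
  have := arc_odd aij; have := arc_lt aij; lia.
split=> [[_ KL] i j aij|Llink].
  have := gapE _ _ aij; have ij := arc_lt aij; have jn := ltn_ord j; move=> dE.
  exists (half_gap a i); split; first lia.
  have := KL i (arc_opening aij); rewrite (arc_partner aij) => sj.
  apply/eqP; rewrite eqEdim {1}sj capvSr /= step_dim // dim_lpreim_step //; lia.
have sL : springer L.
  apply/linked_springer.
  have [|||//] := @noncrossing_ind n a (linked L).
  - exact: linked_refl.
  - exact: linked_trans.
  - by move=> i j /Llink.
split=> // i io; have aij := opening_arc io; have [d [dE sj]] := Llink _ _ aij.
have := gapE _ _ aij; have ij := arc_lt aij => gE.
have dg : d = half_gap a i by lia.
rewrite /zn_preim -dg -sj; apply/esym/capv_idPr.
by move: (sL); rewrite /springer /= => <-; apply: step_sub.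
Qed.

Lemma Kset_Sset (a : matching n) L : Kset a L <-> Sset a (invol (phi L)).
Proof.
rewrite Kset_linked Sset_line.
pose nci := @noncrossing_ind n a _ (linked_refl L) (@linked_trans _ _ _ L).
split=> H.
  have [|inner _] := nci; first by move=> i j /H.
  by move=> i j aij; apply/(linked_arc hN (ltn_ord j)); case: (inner _ _ aij).
have [|inner _] := nci; last by move=> i j /inner[].
by move=> i j aij ij; apply/(linked_arc hN (ltn_ord j)) => //; apply: H.
Qed.

(** Fung's theorem, for the matching of the Dyck path of heights. *)
Lemma springer_covered L : springer L -> exists a : matching n, Kset a L.
Proof.
move=> sL; have := @dyck_matching n (height L).
case=> [//||k kn|a aP].
- have [_ _ bmax] := depthP (step (val L) (2 * n)).
  suff : (n <= depth (step (val L) (2 * n)))%N by rewrite /height; lia.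
  by apply: bmax; [lia | rewrite -Esub_lker sL].
- exact: height_step.
exists a; apply/Kset_linked.
have [||i j aij|inner _] := @noncrossing_ind n a (linked L).
- exact: linked_refl.
- exact: linked_trans.
- have [hij H] := aP _ _ aij; apply: linked_first_return => //.
    by rewrite (arc_lt aij) ltn_ord.
  by apply: H; rewrite leqnn (arc_lt aij).
by move=> i j /inner[].
Qed.

Lemma image_Kset (a : matching n) :
  ((@invol C _ \o @phi C N (2 * n)) @` @Kset n a C N = @Sset n a C)%classic.
Proof.
apply/seteqP; split=> [_ [L /Kset_Sset LS <-] //|l Sl].
have [L LE] := phi_surj (invol l) hN.
by exists L; rewrite /= ?LE ?involK //; apply/Kset_Sset; rewrite LE involK.
Qed.

Lemma image_springer :
  ((@invol C _ \o @phi C N (2 * n)) @` @springer C N n = @Stilde C n)%classic.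
Proof.
apply/seteqP; split=> [_ [L /springer_covered[a Ka] <-]|l [a _]].
  by exists a => //; rewrite -image_Kset; exists L.
by rewrite -image_Kset => -[L [sL _] <-]; exists L.
Qed.
End Main.

Local Open Scope classical_set_scope.
Local Open Scope ring_scope.

Theorem proposition1p3 (R : realType) (N n : nat)
    (hn : (1 <= n)%N) (hN : (2 * n <= N)%N) :
  (forall a : matching n,
     (@invol R[i] (2 * n) \o @phi R[i] N (2 * n)) @` @Kset n a R[i] N
     = @Sset n a R[i])
  /\
  (@invol R[i] (2 * n) \o @phi R[i] N (2 * n)) @` @springer R[i] N n
  = @Stilde R[i] n.
Proof.
by split=> [a|]; [apply: image_Kset | apply: image_springer].
Qed.
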